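(* Let $p(z)$ be a polynomial with complex coefficients of degree $n\ge 2$. Let $\varepsilon\in[0,1)$ and let $z_0\in\mathbb{C}$ be a seed with $|p(z_0)|>\varepsilon$. Let $S_0=\{z\in\mathbb{C}: |p(z)|\le |p(z_0)|\}$, and let $\widehat O^+(z_0)=\{z_t\}_{t\ge 0}$ be the orbit of $z_0$ under the Robust Newton Method (RNM). Then: (i) $\widehat O^+(z_0)\subset S_0$. (ii) Let $$A_0=\max\left\{\frac{|p^{(j)}(z)|}{j!}: j=0,\dots,n,\ z\in S_0\right\}.$$ If $\varepsilon>0$, the smallest number of iterations $t$ for which $|p(z_t)|\le\varepsilon$ or $|p(z_t)p'(z_t)|\le\varepsilon$ satisfies $$t\le \frac{9A_0^2\,|p(z_0)|^2}{\varepsilon^2}=O\left(\frac1{\varepsilon^2}\right).$$ (iii) Let $M=\min\{|p(w)|: p'(w)=0,\ p(w)\ne 0\}$ (with $M=+\infty$ if there is no such $w$). If $|p(z_0)|\le M$, then $\widehat O^+(z_0)$ converges to a root of $p$. (iv) For any root $\theta$ of $p$, the RNM basin of attraction $\widehat{\mathcal A}(\theta)$ contains an open disc centered at $\theta$. (v) If $c$ is a critical point of $p$ (i.e. $p'(c)=0$) with $p(c)\neq 0$, then in any neighborhood of $c$ there exists $z$ such that, with $z'=\widehat N_p(z)$, one has $|p(z')|<|p(c)|$, so that $\widehat O^+(z)$ does not converge to $c$.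
   Context: For a complex polynomial $p$ of degree $n\ge 2$ and $z\in\mathbb{C}$ with $p(z)\ne 0$, define $k=k(z)=\min\{j\ge 1: p^{(j)}(z)\ne 0\}$, $A(z)=\max\{|p^{(j)}(z)|/j! : j=0,\dots,n\}$, $u_k=u_k(z)=\frac{1}{k!}p(z)\overline{p^{(k)}(z)}$, $\gamma=2\,\mathrm{Re}(u_k^{k-1})$, $\delta=-2\,\mathrm{Im}(u_k^{k-1})$, $c_k=\max\{|\gamma|,|\delta|\}$ (with $u_k^{0}=1$). Let $\theta_z$ be any angle satisfying: $\theta_z=0$ if $c_k=|\gamma|$ and $\gamma<0$; $\theta_z=\pi/k$ if $c_k=|\gamma|$ and $\gamma>0$; $\theta_z=\pi/(2k)$ if $c_k=|\delta|$ and $\delta<0$; $\theta_z=3\pi/(2k)$ if $c_k=|\delta|$ and $\delta>0$ (if two cases apply, either value may be chosen). The Robust Newton iterate at $z$ is $$\widehat N_p(z)=z+\frac{C_k}{3}\frac{u_k}{|u_k|}e^{i\theta_z},\qquad C_k=\frac{c_k|u_k|^{2-k}}{6A^2(z)}.$$ (When $k=1$ this equals $z-\frac{p(z)\overline{p'(z)}}{9A^2(z)}$.) The Robust Newton Method (RNM) is the iteration $z_{t+1}=\widehat N_p(z_t)$; the resulting sequence starting at $z_0$ is the RNM orbit $\widehat O^+(z_0)$. If an iterate is a root of $p$, the orbit is taken to stay at that root. The RNM basin of attraction $\widehat{\mathcal A}(\theta)$ of a root $\theta$ of $p$ is the set of all seeds whose RNM orbit converges to $\theta$. *)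

(* Defs.v *)
From mathcomp Require Import all_boot all_order all_algebra.
From mathcomp Require Import complex.
From mathcomp Require Import all_classical all_reals all_analysis.

Set Implicit Arguments.
Unset Strict Implicit.
Unset Printing Implicit Defensive.

Import Order.TTheory GRing.Theory Num.Theory.
Import numFieldNormedType.Exports.

Local Open Scope classical_set_scope.
Local Open Scope ring_scope.

(* The norm [`|z|] of R[i] takes its values in R[i]; [cabs] is the modulus as
   an element of R. *)
Notation cabs z := (ComplexField.Normc.normc z).

Definition expi (R : realType) (a : R) : R[i] := (cos a +i* sin a)%C.

Section RobustNewton.
Variable R : realType.
Implicit Types (p : {poly R[i]}) (z : R[i]).

(* The modulus of the j-th Taylor coefficient of p at z. *)
Definition taylor_abs p z (j : nat) : R := cabs (p^`(j).[z] / j`!%:R).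

Definition rnm_A p z : R := \big[Num.max/0]_(j < size p) taylor_abs p z j.

(* With n = (size p).-1 the degree of p, the minimum is taken over
   1 <= j <= n.  When n >= 1 the default value n is itself admissible, since
   p^`(n) is a nonzero constant. *)
Definition rnm_k p z : nat :=
  [arg min_(j < (ord_max : 'I_(size p).-1.+1) |
      (0 < j)%N && (p^`(j).[z] != 0)) (j : nat)].

Definition rnm_u p z : R[i] :=
  let k := rnm_k p z in (k`!%:R)^-1 * (p.[z] * (p^`(k).[z])^*%C).

Definition rnm_gamma p z : R := 2 * complex.Re (rnm_u p z ^+ (rnm_k p z).-1).

Definition rnm_delta p z : R :=
  - (2 * complex.Im (rnm_u p z ^+ (rnm_k p z).-1)).

Definition rnm_c p z : R := Num.max `|rnm_gamma p z| `|rnm_delta p z|.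

(* [rnm_angle p z a]: a is an admissible value of the angle at z.  The cases
   may overlap, in which case several angles are admissible. *)
Definition rnm_angle p z (a : R) : Prop :=
  let k := (rnm_k p z)%:R in
  [\/ [/\ rnm_c p z = `|rnm_gamma p z|, rnm_gamma p z < 0 & a = 0],
      [/\ rnm_c p z = `|rnm_gamma p z|, 0 < rnm_gamma p z & a = pi / k],
      [/\ rnm_c p z = `|rnm_delta p z|, rnm_delta p z < 0 & a = pi / (2 * k)]
    | [/\ rnm_c p z = `|rnm_delta p z|, 0 < rnm_delta p z
        & a = 3 * pi / (2 * k)] ].

(* The exponent 2 - k is an integer, negative when k > 2. *)
Definition rnm_C p z : R :=
  rnm_c p z * cabs (rnm_u p z) ^ (2 - (rnm_k p z)%:Z) / (6 * rnm_A p z ^+ 2).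

(* The iterate at z for the angle a; meaningful when p.[z] != 0. *)
Definition rnm_iterate p z (a : R) : R[i] :=
  z + (rnm_C p z / 3)%:C%C * (rnm_u p z / (cabs (rnm_u p z))%:C%C) * expi a.

(* Below, R[i]^o carries the topology of the numFieldType R[i], and theta selects an angle at each point. *)
Implicit Types (theta : R[i] -> R).

Definition rnm_step p theta z : R[i] :=
  if p.[z] == 0 then z else rnm_iterate p z (theta z).

Definition rnm_orbit p theta z0 (t : nat) : R[i] := iter t (rnm_step p theta) z0.

Definition rnm_basin p theta (r : R[i]) : set R[i] :=
  [set z | (rnm_orbit p theta z : nat -> R[i]^o) @ \oo --> (r : R[i]^o)].

Definition sublevel p z0 : set R[i] := [set z | cabs p.[z] <= cabs p.[z0]].

Definition taylor_abs_on p (S : set R[i]) : set R :=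
  [set a | exists (j : nat) (z : R[i]),
     [/\ (j <= (size p).-1)%N, S z & a = taylor_abs p z j]].

Definition critical_moduli p : set (\bar R) :=
  [set (cabs p.[w])%:E | w in [set w | p^`().[w] = 0 /\ p.[w] <> 0]].

End RobustNewton.

Definition is_max d (T : porderType d) (S : set T) (a : T) : Prop :=
  S a /\ ubound S a.

(* The minimum of S, with the convention that the minimum of the empty set
   is +oo. *)
Definition is_emin (R : realType) (S : set (\bar R)) (a : \bar R) : Prop :=
  (S a /\ lbound S a) \/ (S = set0 /\ a = +oo%E).

(* Main.v *)
(* Write a_j = p^(j)(z)/j! and let r be the length of the step h at z.  Since
   a_j = 0 for 0 < j < k, and the direction of h makes
   2 Re(conj(a_0) a_k h^k) = - c_k |u_k|^(2-k) r^k = - 18 A^2 r^(k+1), while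
   r <= 1/9 bounds the rest of |p(z+h)|^2 by 4 A^2 r^(k+1), one gets
   |p(z+h)|^2 <= |p(z)|^2 - 14 A^2 r^(k+1).  This yields (i) and, taking z = c,
   (v).  Before the stopping time k = 1 and r = |p p'|/(9 A^2), so |p|^2 drops by
   at least eps^2/(9 A_0^2) per step, which is (ii).  Below the least nonzero
   critical modulus, compactness bounds |p'| from below as long as |p| stays
   away from 0, hence p(z_t) -> 0 by the same count.  Step lengths are at most
   |p(z_t)|/|lc p| and the roots are isolated, so once |p| is small the orbit can
   no longer leave the root it is close to: (iii) and (iv). *)
Require Import Defs.
From mathcomp Require Import all_boot all_order all_algebra.
From mathcomp Require Import complex.
From mathcomp Require Import all_classical all_reals all_analysis.
From mathcomp Require Import ring lra zify.

Set Implicit Arguments.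
Unset Strict Implicit.
Unset Printing Implicit Defensive.

Import Order.TTheory GRing.Theory Num.Theory.
Import numFieldNormedType.Exports.

Local Open Scope classical_set_scope.
Local Open Scope ring_scope.

(** * Moduli of complex numbers and the one-step decrease estimate *)

Section Modulus.
Variable R : realType.
Implicit Types (x y z : R[i]) (a r : R).
Import ComplexField.Normc.

Lemma cabs0 : cabs (0 : R[i]) = 0.
Proof. by rewrite /= expr0n addr0 sqrtr0. Qed.

Lemma cabs1 : cabs (1 : R[i]) = 1.
Proof. by rewrite /= expr0n expr1n addr0 sqrtr1. Qed.

Lemma cabsE z : (cabs z)%:C%C = `|z|. Proof. by case: z. Qed.

Lemma cabs_ge0 z : 0 <= cabs z. Proof. by case: z => a b; exact: sqrtr_ge0. Qed.

Lemma cabs_eq0 z : (cabs z == 0) = (z == 0).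
Proof. by apply/eqP/eqP => [/eq0_normc//|->]; exact: cabs0. Qed.

Lemma cabs_gt0 z : (0 < cabs z) = (z != 0).
Proof. by rewrite lt_def cabs_ge0 andbT cabs_eq0. Qed.

Lemma cabsX z m : cabs (z ^+ m) = cabs z ^+ m.
Proof. by elim: m => [|m IH]; rewrite ?cabs1// !exprS normcM IH. Qed.

Lemma cabs_real a : cabs a%:C%C = `|a|.
Proof. by rewrite /= expr0n addr0 sqrtr_sqr. Qed.

Lemma cabs_conj z : cabs (z^*)%C = cabs z.
Proof. by case: z => a b /=; rewrite sqrrN. Qed.

Lemma cabsD x y : cabs (x + y) <= cabs x + cabs y.
Proof. exact: le_normcD. Qed.

Lemma cabsN z : cabs (- z) = cabs z. Proof. exact: normcN. Qed.

Lemma cabsC x y : cabs (x - y) = cabs (y - x).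
Proof. by rewrite -cabsN opprB. Qed.

Lemma cabs_sum (I : Type) (s : seq I) (P : pred I) (F : I -> R[i]) :
  cabs (\sum_(i <- s | P i) F i) <= \sum_(i <- s | P i) cabs (F i).
Proof.
elim/big_ind2: _ => [|x a y b hx hy|//]; first by rewrite cabs0.
exact: le_trans (cabsD _ _) (lerD hx hy).
Qed.

Lemma cabs_prod (I : Type) (s : seq I) (F : I -> R[i]) :
  cabs (\prod_(i <- s) F i) = \prod_(i <- s) cabs (F i).
Proof.
by elim: s => [|x s IH]; rewrite ?(big_nil, big_cons) ?cabs1// normcM IH.
Qed.

Lemma cabsB_ge x y : cabs x - cabs y <= cabs (x - y).
Proof. by rewrite lerBlDr (le_trans _ (cabsD _ _))// subrK. Qed.

Lemma cabs_dist x y : `|cabs x - cabs y| <= cabs (x - y).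
Proof. by rewrite ler_norml lerNl opprB (cabsB_ge x) cabsC cabsB_ge. Qed.

Lemma cabs_sqrD x y :
  cabs (x + y) ^+ 2 =
  cabs x ^+ 2 + 2 * complex.Re ((x^*)%C * y) + cabs y ^+ 2.
Proof.
case: x y => [a b] [c d] /=.
rewrite !sqr_sqrtr ?addr_ge0 ?sqr_ge0//; ring.
Qed.

Lemma Re_realM a z : complex.Re (a%:C%C * z) = a * complex.Re z.
Proof. by case: z => b c /=; rewrite mul0r subr0. Qed.

Lemma conj_mul_self z : (z^*)%C * z = (cabs z ^+ 2)%:C%C.
Proof. by rewrite mulrC -sqr_normc -cabsE rmorphXn. Qed.

Lemma expiD a b : expi (a + b) = expi a * expi b.
Proof.
apply/eqP; rewrite eq_complex /= cosD sinD eqxx/=; apply/eqP; ring.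
Qed.

Lemma expiX a m : expi a ^+ m = expi (m%:R * a).
Proof.
elim: m => [|m IH]; first by rewrite mul0r /expi cos0 sin0.
by rewrite exprS IH -expiD -[m.+1]add1n natrD mulrDl mul1r.
Qed.

Lemma cabs_expi a : cabs (expi a) = 1.
Proof. by rewrite /= cos2Dsin2 sqrtr1. Qed.

Lemma cabs_polar r z a : 0 < r -> z != 0 ->
  cabs (r%:C%C * (z / (cabs z)%:C%C) * expi a) = r.
Proof.
move=> r0 z0; rewrite !normcM cabs_expi normcV !cabs_real mulr1.
by rewrite (gtr0_norm r0) ger0_norm ?cabs_ge0// divff ?mulr1// cabs_eq0.
Qed.

(* The lowest-order term [a_k h^k], chosen against [a_0], outweighs the tail
   and the square of the increment as soon as [cabs h <= 1/9]. *)
Lemma taylor_decrease (n k : nat) (a : nat -> R[i]) (A : R) (h : R[i]) :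
  (0 < k <= n)%N -> (forall j, (0 < j < k)%N -> a j = 0) ->
  (forall j, (j <= n)%N -> cabs (a j) <= A) -> cabs h <= 1 / 9 ->
  2 * complex.Re (((a 0%N)^*)%C * (a k * h ^+ k)) =
    - (18 * A ^+ 2 * cabs h ^+ k.+1) ->
  cabs (\sum_(j < n.+1) a j * h ^+ j) ^+ 2 <=
    cabs (a 0%N) ^+ 2 - 14 * A ^+ 2 * cabs h ^+ k.+1.
Proof.
move=> /andP[k0 kn] ak aA; set r := cabs h => r9 Hre.
have r0 : 0 <= r by exact: cabs_ge0.
have A0 : 0 <= A := le_trans (cabs_ge0 _) (aA 0%N isT).
(* As [r <= 1/9], a geometric sum is at most [1/(1 - 1/9) = 9/8] times its first term. *)
have geom m d : \sum_(m <= j < m + d) r ^+ j <= 9 / 8 * r ^+ m.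
  elim: d m => [|d IH] m.
    by rewrite addn0 big_geq// mulr_ge0 ?exprn_ge0//; lra.
  rewrite big_ltn; last by rewrite addnS ltnS leq_addr.
  rewrite addnS -addSn; apply: (le_trans (lerD (lexx _) (IH _))).
  rewrite exprS; have : 0 <= r ^+ m by rewrite exprn_ge0.
  nra.
have tail m : (m <= n.+1)%N ->
    cabs (\sum_(m <= j < n.+1) a j * h ^+ j) <= 9 / 8 * (A * r ^+ m).
  move=> mn; apply: (le_trans (cabs_sum _ _ _)).
  apply: (@le_trans _ _ (\sum_(m <= j < n.+1) A * r ^+ j)).
    rewrite !big_nat; apply: ler_sum => j /andP[_ jn].
    by rewrite normcM cabsX ler_wpM2r ?exprn_ge0// aA.
  rewrite -mulr_sumr mulrCA ler_wpM2l// -(subnKC mn); exact: geom.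
have skip : \sum_(1 <= j < n.+1) a j * h ^+ j =
    \sum_(k <= j < n.+1) a j * h ^+ j.
  rewrite (@big_cat_nat _ _ _ k)//=; last exact: leqW.
  by rewrite big_nat big1 ?add0r// => j /ak ->; rewrite mul0r.
rewrite -(big_mkord xpredT (fun j => a j * h ^+ j)) big_ltn// expr0 mulr1.
rewrite skip cabs_sqrD.
have /(le_trans (cabs_ge0 _)) := tail k (leqW kn).
have := tail k (leqW kn); have := tail k.+1 kn; rewrite -/r.
have -> : \sum_(k <= j < n.+1) a j * h ^+ j =
    a k * h ^+ k + \sum_(k.+1 <= j < n.+1) a j * h ^+ j by rewrite big_ltn.
set v := \sum_(_ <= j < _) _; set w := _ + v => hv hw hw0.
have ReD (x y : R[i]) : complex.Re (x + y) = complex.Re x + complex.Re y.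
  by case: x y => [? ?] [].
have Re_le (x : R[i]) : complex.Re x <= cabs x.
  rewrite -lecR cabsE; apply: le_trans (normc_ge_Re x).
  by rewrite lecR ler_norm.
have hre2 : complex.Re (((a 0%N)^*)%C * v) <= 9 / 8 * A ^+ 2 * r ^+ k.+1.
  apply: (le_trans (Re_le _)); rewrite normcM cabs_conj.
  rewrite (_ : 9 / 8 * _ * _ = A * (9 / 8 * (A * r ^+ k.+1))); last by ring.
  by rewrite ler_pM ?cabs_ge0// aA.
have hw2 : cabs w ^+ 2 <= (9 / 8) ^+ 2 * (A ^+ 2 * r ^+ k.+1).
  apply: (@le_trans _ _ ((9 / 8 * (A * r ^+ k)) ^+ 2)).
    by rewrite lerXn2r ?nnegrE ?cabs_ge0.
  rewrite !exprMn ler_wpM2l ?sqr_ge0// ler_wpM2l ?sqr_ge0// -exprM.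
  (* Since [r <= 1] and [k >= 1], passing from exponent [2k] down to [k + 1] can only increase the
     power. *)
  by apply: ler_wiXn2l => //; [lra|lia].
(* The cross term costs at most [2 * 9/8] and the square at most [(9/8)^2]; together they stay below
   [4 = 18 - 14]. *)
rewrite mulrDr ReD mulrDr Hre.
have : 0 <= A ^+ 2 * r ^+ k.+1 by rewrite mulr_ge0 ?sqr_ge0 ?exprn_ge0.
lra.
Qed.

End Modulus.

(** * One step of the method *)

Section Step.
Variables (R : realType) (n : nat) (p : {poly R[i]}).
Hypotheses (n_gt0 : (0 < n)%N) (size_p : size p = n.+1).
Implicit Types (z : R[i]) (j : nat).
Import ComplexField.Normc.

Lemma taylor_absE z j : taylor_abs p z j = cabs p^`N(j).[z].
Proof.
rewrite /taylor_abs nderivn_def hornerMn -mulr_natr mulfK//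
  pnatr_eq0 -lt0n fact_gt0.
Qed.

Lemma nderivn_lead z : p^`N(n).[z] = lead_coef p.
Proof.
rewrite [p^`N(n)](_ : _ = (lead_coef p)%:P) ?hornerC//.
apply/polyP => i; rewrite coef_nderivn coefC lead_coefE size_p /=.
case: i => [|i]; first by rewrite addn0 binn.
by rewrite nth_default ?mul0rn// size_p addnS !ltnS leq_addr.
Qed.

Lemma lead_gt0 : 0 < cabs (lead_coef p).
Proof. by rewrite cabs_gt0 lead_coef_eq0 -size_poly_eq0 size_p. Qed.

Lemma derivn_eq0 z j : (p^`(j).[z] == 0) = (p^`N(j).[z] == 0).
Proof.
by rewrite nderivn_def hornerMn -mulr_natr mulf_eq0
  pnatr_eq0 eqn0Ngt fact_gt0 orbF.
Qed.

Lemma rnm_kP z : [/\ (0 < rnm_k p z <= n)%N, p^`N(rnm_k p z).[z] != 0 &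
  forall j, (0 < j < rnm_k p z)%N -> p^`N(j).[z] = 0].
Proof.
rewrite /rnm_k; case: arg_minnP => /= [|i /andP[i0 hi] imin].
  by rewrite size_p /= n_gt0 derivn_eq0 nderivn_lead -cabs_gt0 lead_gt0.
have in_ : (i <= n)%N by rewrite (leq_trans (leq_ord i))// size_p.
split; rewrite ?i0 -?derivn_eq0// => j /andP[j0 ji].
apply/eqP; rewrite -derivn_eq0; apply/negPn/negP => hj.
have jn : (j < (size p).-1.+1)%N by rewrite size_p ltnS (leq_trans (ltnW ji)).
by have := imin (Ordinal jn); rewrite /= j0 hj leqNgt ji => /(_ isT).
Qed.

Lemma rnm_uE z : rnm_u p z = p.[z] * (p^`N(rnm_k p z).[z]^*)%C.
Proof.
rewrite /rnm_u; set k := rnm_k p z; rewrite nderivn_def hornerMn rmorphMn /=.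
rewrite !mulrnAr -mulrnAl -[_ *+ k`!]mulr_natr mulVf ?mul1r//
  pnatr_eq0 -lt0n fact_gt0.
Qed.

Lemma rnm_A_ge z j : (j <= n)%N -> cabs p^`N(j).[z] <= rnm_A p z.
Proof.
move=> jn; rewrite -taylor_absE /rnm_A.
have jp : (j < size p)%N by rewrite size_p.
exact: (le_bigmax _ _ (Ordinal jp)).
Qed.

(** The Taylor coefficient of index [n] does not depend on the point, so [A] has a uniform positive
    lower bound; step lengths can then be controlled by the modulus of [p] alone. *)
Lemma lead_le_rnm_A z : cabs (lead_coef p) <= rnm_A p z.
Proof. by rewrite -(nderivn_lead z) rnm_A_ge. Qed.

Lemma rnm_A_gt0 z : 0 < rnm_A p z.
Proof. exact: lt_le_trans lead_gt0 (lead_le_rnm_A z). Qed.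

Lemma rnm_A_le z (B : R) : 0 <= B ->
  (forall j, (j <= n)%N -> taylor_abs p z j <= B) -> rnm_A p z <= B.
Proof.
move=> B0 hB; apply: bigmax_le => // j _; apply: hB.
by rewrite -ltnS -size_p.
Qed.

(** Multiplied by [k], the four angles become 0, pi, pi/2 and 3pi/2, so the rotation is by 1, -1, i
    or -i. It turns the dominant one of the real and imaginary parts of [u^(k-1)] into a negative
    real part; the strict sign in each case gives [0 < c]. *)
Lemma rnm_angleP z a : rnm_angle p z a -> [/\ 0 < rnm_c p z,
  rnm_c p z <= 2 * cabs (rnm_u p z) ^+ (rnm_k p z).-1 &
  2 * complex.Re (rnm_u p z ^+ (rnm_k p z).-1 * expi ((rnm_k p z)%:R * a)) =
    - rnm_c p z].
Proof.
have [/andP[k0 _] _ _] := rnm_kP z.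
rewrite /rnm_angle /rnm_c /rnm_gamma /rnm_delta.
set k := rnm_k p z in k0 *; have k0' : (k%:R : R) != 0.
  by rewrite pnatr_eq0 -lt0n.
rewrite -cabsX; case: (rnm_u p z ^+ _) => x y /=.
have xle : `|x| <= Num.sqrt (x ^+ 2 + y ^+ 2).
  by rewrite -sqrtr_sqr ler_wsqrtr// lerDl sqr_ge0.
have yle : `|y| <= Num.sqrt (x ^+ 2 + y ^+ 2).
  by rewrite -sqrtr_sqr ler_wsqrtr// lerDr sqr_ge0.
rewrite normrN !normrM (@ger0_norm _ 2)//.
have cle : Num.max (2 * `|x|) (2 * `|y|) <= 2 * Num.sqrt (x ^+ 2 + y ^+ 2).
  by rewrite ge_max !ler_pM2l// xle.
case => -[-> hs ->]; split; rewrite /= ?ler_pM2l//.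
- by rewrite mulr_gt0// normr_gt0; apply: contraTneq hs => ->; rewrite mulr0 ltxx.
-  by rewrite mulr0 cos0 sin0 ltr0_norm; lra.
- by rewrite mulr_gt0// normr_gt0; apply: contraTneq hs => ->; rewrite mulr0 ltxx.
- rewrite mulrCA divff// mulr1 cospi sinpi gtr0_norm; lra.
- by rewrite mulr_gt0// normr_gt0; apply: contraTneq hs => ->;
    rewrite mulr0 oppr0 ltxx.
- rewrite (_ : k%:R * _ = pi / 2); last by field.
  by rewrite cos_pihalf sin_pihalf gtr0_norm; lra.
- by rewrite mulr_gt0// normr_gt0; apply: contraTneq hs => ->;
    rewrite mulr0 oppr0 ltxx.
- rewrite (_ : k%:R * _ = pi / 2 + pi); last by field.
  by rewrite cosDpi sinDpi cos_pihalf sin_pihalf ltr0_norm; lra.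
Qed.

(** With [h = (r/|u|) u e^(ia)] and [conj(a_0) a_k = conj(u)], the term [conj(a_0) a_k h^k] is a
    positive multiple of [u^(k-1) e^(ika)], whose real part [rnm_angleP] supplies. The bound on [r]
    comes from [c <= 2 |u|^(k-1)], an equality when [k = 1]. *)
Lemma rnm_iterateP z a : p.[z] != 0 -> rnm_angle p z a ->
  let r := cabs (rnm_iterate p z a - z) in
  [/\ 0 < r, r <= cabs (rnm_u p z) / (9 * rnm_A p z ^+ 2),
     rnm_k p z = 1%N -> r = cabs (rnm_u p z) / (9 * rnm_A p z ^+ 2) &
     cabs p.[rnm_iterate p z a] ^+ 2 <=
       cabs p.[z] ^+ 2 - 14 * rnm_A p z ^+ 2 * r ^+ (rnm_k p z).+1].
Proof.
move=> pz ha /=; have [k0n pk pj] := rnm_kP z.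
have [c0 cle hRe] := rnm_angleP ha.
have A0 := rnm_A_gt0 z.
have U0 : 0 < cabs (rnm_u p z).
  by rewrite cabs_gt0 rnm_uE mulf_neq0// -cabs_gt0 cabs_conj cabs_gt0.
rewrite /rnm_iterate addrC addKr /rnm_C.
have Age := rnm_A_ge z.
have ck1 : rnm_k p z = 1%N -> rnm_c p z = 2.
  move=> k1; rewrite /rnm_c /rnm_gamma /rnm_delta k1 expr0 /= mulr0 oppr0 normr0.
  by rewrite mulr1 ger0_norm//; apply/max_idPl.
set A := rnm_A p z in A0 Age *; set c := rnm_c p z in c0 cle hRe ck1 *.
have uE := rnm_uE z.
set u := rnm_u p z in U0 cle hRe uE *; set U := cabs u in U0 cle *.
set k := rnm_k p z in k0n pk pj cle hRe uE ck1 *.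
clearbody A c u k; set h := _%:C%C * _ * _.
have /andP[k0 kn] := k0n.
set V := U ^ (2 - k%:Z).
have V0 : 0 < V by rewrite exprz_gt0.
have VU : V * U ^+ k = U ^+ 2.
  by rewrite /V !exprnP -expfzDr ?gt_eqF// subrK.
have VU1 : V * U ^+ k.-1 = U.
  apply: (mulIf (lt0r_neq0 U0)).
  by rewrite -mulrA -exprSr prednK// VU expr2.
set r := c * V / (6 * A ^+ 2) / 3.
have r0 : 0 < r by rewrite !divr_gt0 ?mulr_gt0 ?exprn_gt0.
have hr : cabs h = r.
  by apply: cabs_polar => //; rewrite -cabs_gt0.
have rle : r <= U / (9 * A ^+ 2).
  have -> : r = c * V / 2 / (9 * A ^+ 2) by rewrite /r; field; rewrite gt_eqF.
  rewrite ler_pM2r ?invr_gt0 ?mulr_gt0 ?exprn_gt0//.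
  have : c * V <= 2 * (V * U ^+ k.-1); last by rewrite VU1; lra.
  by rewrite [V * _]mulrC mulrA ler_wpM2r// ltW.
rewrite hr; split => // [k1|].
  rewrite /r (ck1 k1) (_ : V = U); last by rewrite -[LHS]mulr1 -VU1 k1.
  by field; rewrite gt_eqF.
rewrite [z + h]addrC addrC nderiv_taylor; last exact: mulrC.
rewrite size_p -hr -[in X in _ <= X](nderivn0 p).
apply: (@taylor_decrease _ _ k (fun j => p^`N(j).[z])) => //.
(* [U] is a product of two Taylor moduli, hence at most [A^2], and the bound on [r] becomes 1/9. *)
- rewrite hr (le_trans rle)// ler_pdivrMr ?mulr_gt0 ?exprn_gt0//.
  have : U <= A ^+ 2; last by lra.
  rewrite /U uE normcM cabs_conj expr2 ler_pM ?cabs_ge0 ?Age//.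
  by rewrite -[p in p.[z]](nderivn0 p) Age.
rewrite hr nderivn0 mulrA.
have -> : (p.[z]^*)%C * p^`N(k).[z] = (u^*)%C.
  by rewrite uE rmorphM /= conjcK.
have -> : h ^+ k = ((r / U) ^+ k)%:C%C * u ^+ k * expi (k%:R * a).
  rewrite -expiX rmorphXn -!exprMn; congr (_ ^+ k); rewrite /h -/r -/U.
  have rU : (r / U)%:C%C = r%:C%C / U%:C%C :> R[i] by rewrite rmorphM fmorphV.
  by rewrite -[X in X * u * _]/((r / U)%:C%C) rU; ring.
have -> : (u^*)%C * (((r / U) ^+ k)%:C%C * u ^+ k * expi (k%:R * a)) =
    (r ^+ k * V)%:C%C * (u ^+ k.-1 * expi (k%:R * a)).
  rewrite -[X in u ^+ X](prednK k0) exprS.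
  transitivity ((u^*)%C * u * ((r / U) ^+ k)%:C%C *
      (u ^+ k.-1 * expi (k%:R * a))); first by ring.
  (* Writing [|u|^2] as [V * U^k] cancels the denominator of [(r/U)^k]. *)
  rewrite conj_mul_self -rmorphM -/U -VU expr_div_n; congr (_%:C%C * _).
  by rewrite mulrAC -mulrA mulrC divfK ?expf_neq0 ?gt_eqF.
(* The 18 is the 6 in [C_k] times the 3 dividing it in the iterate. *)
have cV : c * V = 18 * A ^+ 2 * r by rewrite /r; field; rewrite gt_eqF.
rewrite Re_realM mulrCA hRe mulrN; congr (- _).
transitivity (r ^+ k * (c * V)); first by ring.
by rewrite cV (exprS r); ring.
Qed.

End Step.

(** * Roots and sublevel sets of complex polynomials *)

Section Roots.
Variable R : realType.
Implicit Types (q : {poly R[i]}) (z : R[i]).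
Import ComplexField.Normc.

(** In the factorization of [q], if every root were at distance at least [d] from [z], the product
    of the distances would be at least [d^n]. This is how small values of [p] are turned into
    closeness to a root. *)
Lemma root_near q z (d : R) : 0 < d ->
  cabs q.[z] < cabs (lead_coef q) * d ^+ (size q).-1 ->
  exists2 w, root q w & cabs (z - w) < d.
Proof.
move=> d0; have [s qE] := closed_field_poly_normal q.
have [->|q0] := eqVneq q 0.
  by rewrite horner0 lead_coef0 cabs0 mul0r ltxx.
have sq : (size q).-1 = size s.
  by rewrite qE size_scale ?lead_coef_eq0// size_prod_XsubC.
have rq w : w \in s -> root q w.
  by move=> ws; rewrite qE rootZ ?lead_coef_eq0// root_prod_XsubC.
rewrite {1}qE hornerZ horner_prod normcM cabs_prod sq.
rewrite ltr_pM2l ?cabs_gt0 ?lead_coef_eq0// => hlt.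
have [/hasP[w ws hw]|/hasPn far] := boolP (has (fun w => cabs (z - w) < d) s).
  by exists w => //; exact: rq.
move: hlt; rewrite ltNge => /negP[].
elim: s far {qE sq rq} => [|w s IH] far; first by rewrite big_nil.
rewrite big_cons exprS ler_pM ?exprn_ge0 ?(ltW d0)//.
  by rewrite leNgt hornerXsubC far// mem_head.
by apply: IH => v vs; apply: far; rewrite inE vs orbT.
Qed.

Lemma roots_bounded q : q != 0 ->
  exists2 B : R, 0 < B & forall w, root q w -> cabs w <= B.
Proof.
move=> q0; have [s qE] := closed_field_poly_normal q.
exists (1 + \sum_(w <- s) cabs w).
  by rewrite ltr_wpDr// sumr_ge0// => i _; exact: cabs_ge0.
move=> w; rewrite qE rootZ ?lead_coef_eq0// root_prod_XsubC => ws.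
rewrite (big_rem w)//= addrCA lerDl addr_ge0//.
by rewrite sumr_ge0// => i _; exact: cabs_ge0.
Qed.

Lemma roots_separated q : q != 0 -> exists2 s : R, 0 < s &
  forall v w, root q v -> root q w -> cabs (v - w) < s -> v = w.
Proof.
move=> q0; have [l qE] := closed_field_poly_normal q.
pose P := [seq vw <- [seq (v, w) | v <- l, w <- l] | vw.1 != vw.2].
(* The default 1 keeps the minimum positive when there are no two distinct roots. *)
exists (\big[Order.min/1]_(vw <- P) cabs (vw.1 - vw.2)).
  rewrite big_seq; elim/big_ind: _ => // [x y x0 y0|[v w]].
    by rewrite lt_min x0.
  by rewrite mem_filter => /andP[/= vw _]; rewrite cabs_gt0 subr_eq0.
move=> v w; rewrite qE !rootZ ?lead_coef_eq0// !root_prod_XsubC => vl wl.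
apply: contraTeq => vw; rewrite -leNgt.
apply: (@ge_bigmin_seq _ _ _ _ _ (v, w)) => //.
by rewrite mem_filter /= vw; apply/allpairsP; exists (v, w).
Qed.

(** Convergence in [R[i]^o] is tested with radii in [R[i]]; a positive element there is real, so
    real radii suffice. *)
Lemma near_cabsP {T} {F : set_system T} {FF : Filter F}
    (f : T -> R[i]^o) (l : R[i]^o) :
  (f @ F --> l) <-> forall e : R, 0 < e -> \forall x \near F, cabs (l - f x) < e.
Proof.
split=> [/cvgrPdist_lt H e e0|H].
  have /H : 0 < (e%:C%C : R[i]) by rewrite ltcR.
  by apply: filterS => x; rewrite -cabsE ltcR.
apply/cvgrPdist_lt => e e0.
have eR : (complex.Re e)%:C%C = e by rewrite RRe_real// gtr0_real.
have : 0 < complex.Re e by rewrite -ltcR eR.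
by move=> /H; apply: filterS => x; rewrite -cabsE -ltcR eR.
Qed.

Lemma continuous_cabs : continuous (fun z : R[i]^o => cabs z : R).
Proof.
move=> z; apply: (@cvgrPdist_lt _ _ _ _ (nbhs_filter z) _ _).2 => e e0.
have h := (@near_cabsP _ (nbhs z) (nbhs_filter z) id z).1 cvg_id e e0.
by apply: (@filterS _ (nbhs z) (nbhs_filter z) _ _ _ h) => x;
  apply: le_lt_trans (cabs_dist _ _).
Qed.

Lemma continuous_cabs_horner q :
  continuous (fun z : R[i]^o => cabs q.[z] : R).
Proof.
have cq : continuous (fun z : R[i]^o => q.[z] : R[i]^o).
  elim/poly_ind: q => [|q c IH].
    have -> : (fun z : R[i]^o => (0 : {poly R[i]}).[z] : R[i]^o) = fun=> 0.
      by apply/funext => z; rewrite horner0.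
    by move=> z; apply: (@cvg_cst _ _ _ _ (nbhs_filter z)).
  have -> : (fun z : R[i]^o => (q * 'X + c%:P).[z] : R[i]^o) =
      fun z => q.[z] * z + c by apply/funext => z; rewrite hornerMXaddC.
  move=> z; apply: (@cvgD _ R[i]^o _ _ (nbhs_filter z)); last first.
    exact: (@cvg_cst _ _ _ _ (nbhs_filter z)).
  by apply: (@cvgM _ _ _ (nbhs_filter z)); [exact: IH|exact: cvg_id].
by move=> z; exact: (continuous_comp (cq z) (@continuous_cabs q.[z])).
Qed.

(** The disc is a closed subset of the continuous image of the square [[-B, B]^2] under
    [(x, y) -> x + iy]. *)
Lemma compact_cabs_le (B : R) : compact [set z : R[i]^o | cabs z <= B].
Proof.
pose g (x : R * R) : R[i]^o := (x.1 +i* x.2)%C.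
have cg : continuous g.
  move=> x; apply/near_cabsP => e e0.
  have e2 : 0 < e / 2 by rewrite divr_gt0.
  have /cvgrPdist_lt/(_ _ e2) h1 : (fun y : R * R => y.1) @ x --> x.1
    by exact: cvg_fst.
  have /cvgrPdist_lt/(_ _ e2) h2 : (fun y : R * R => y.2) @ x --> x.2
    by exact: cvg_snd.
  apply: filterS2 h1 h2 => -[y1 y2]; case: x => x1 x2 /= h1 h2.
  have gE : g (x1, x2) - g (y1, y2) = (x1 - y1)%:C%C + 'i%C * (x2 - y2)%:C%C.
    by apply/eqP; rewrite eq_complex /=; apply/andP; split; apply/eqP; ring.
  change (cabs (g (x1, x2) - g (y1, y2)) < e); rewrite gE.
  apply: (le_lt_trans (cabsD _ _)); rewrite normcM !cabs_real.
  have -> : cabs ('i%C : R[i]) = 1 by rewrite /= expr0n expr1n add0r sqrtr1.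
  lra.
have cK : compact (g @` (`[- B, B]%classic `*` `[- B, B]%classic)).
  apply: continuous_compact; first exact: continuous_subspaceT.
  by apply: compact_setX; exact: segment_compact.
apply: subclosed_compact cK _.
  apply: (@preimage_closed _ _ (fun z : R[i]^o => cabs z) [set x | x <= B]).
    by move=> z _; exact: continuous_cabs.
  exact: closed_le.
move=> [x y] /= hB; exists (x, y) => //=.
rewrite !in_itv /= -!ler_norml; split; apply: le_trans hB.
  by rewrite -sqrtr_sqr ler_wsqrtr// lerDl sqr_ge0.
by rewrite -sqrtr_sqr ler_wsqrtr// lerDr sqr_ge0.
Qed.

(** The set is closed by continuity, and bounded because [root_near] puts each of its points within
    [d] of one of the roots, which are themselves bounded. *)
Lemma compact_sublevel q (B : R) : (1 < size q)%N ->
  compact [set z : R[i]^o | cabs q.[z] <= B].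
Proof.
move=> sq; have q0 : q != 0 by rewrite -size_poly_gt0 ltnW.
have [C C0 hC] := roots_bounded q0.
have l0 : 0 < cabs (lead_coef q) by rewrite cabs_gt0 lead_coef_eq0.
(* As [d >= 1], the power [d^deg(q)] is at least [d], and [|lc| d = |lc| + |B|] exceeds [B]. *)
pose d := 1 + `|B| / cabs (lead_coef q).
have d1 : 1 <= d by rewrite lerDl divr_ge0// cabs_ge0.
apply: (subclosed_compact _ (@compact_cabs_le (C + d))).
  apply: (@preimage_closed _ _ (fun z : R[i]^o => cabs q.[z]) [set x | x <= B]).
    by move=> z _; exact: continuous_cabs_horner.
  exact: closed_le.
move=> z /= hz; have [||w rw hw] := @root_near q z d; first lra.
  apply: (@lt_le_trans _ _ (cabs (lead_coef q) * d)).
    rewrite mulrDr mulr1 mulrC divfK ?gt_eqF//.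
    by rewrite (le_lt_trans hz)// (le_lt_trans (ler_norm _))// ltrDr.
  rewrite ler_pM2l// -[X in X <= _]expr1 ler_weXn2l//; lia.
have := cabsD (z - w) w; rewrite subrK; have := hC _ rw; lra.
Qed.

End Roots.

(** * Orbits *)

Section Dynamics.
Variables (R : realType) (n : nat) (p : {poly R[i]}) (theta : R[i] -> R).
Hypotheses (n_gt0 : (0 < n)%N) (size_p : size p = n.+1).
Hypothesis thetaP : forall z : R[i], p.[z] != 0 -> rnm_angle p z (theta z).
Implicit Types (z r : R[i]) (t : nat) (d e : R).
Import ComplexField.Normc.

Local Notation N := (rnm_step p theta).
Local Notation orbit := (rnm_orbit p theta).
Local Notation lc := (cabs (lead_coef p)).

Let p_neq0 : p != 0. Proof. by rewrite -size_poly_gt0 size_p. Qed.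

Let lc_gt0 : 0 < lc. Proof. exact: lead_gt0 size_p. Qed.

Lemma rnm_step_lt z : p.[z] != 0 -> cabs p.[N z] < cabs p.[z].
Proof.
move=> pz; rewrite /rnm_step (negPf pz).
have [r0 _ _ h] := rnm_iterateP n_gt0 size_p pz (thetaP pz).
rewrite -(@ltr_pXn2r _ 2) ?nnegrE ?cabs_ge0//.
apply: (le_lt_trans h); rewrite ltrBlDr ltrDl.
by rewrite !mulr_gt0 ?exprn_gt0// (rnm_A_gt0 size_p).
Qed.

Lemma rnm_step_root z : p.[z] = 0 -> N z = z.
Proof. by move=> pz; rewrite /rnm_step pz eqxx. Qed.

Lemma rnm_step_le z : cabs p.[N z] <= cabs p.[z].
Proof.
by have [/rnm_step_root->//|pz] := eqVneq p.[z] 0; rewrite ltW// rnm_step_lt.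
Qed.

(** The length is at most [|p| |a_k| / (9 A^2)], where [|a_k| <= A] and [|lc| <= A]; the factor 9 is
    dropped. *)
Lemma rnm_step_dist z : cabs (N z - z) <= cabs p.[z] / lc.
Proof.
have [/rnm_step_root->|pz] := eqVneq p.[z] 0.
  by rewrite subrr cabs0 divr_ge0 ?cabs_ge0.
rewrite /rnm_step (negPf pz).
have [_ h _ _] := rnm_iterateP n_gt0 size_p pz (thetaP pz).
have A0 := rnm_A_gt0 size_p z; have lA := lead_le_rnm_A size_p z.
have [/andP[_ kn] _ _] := rnm_kP n_gt0 size_p z.
apply: (le_trans h); rewrite rnm_uE normcM cabs_conj.
have := rnm_A_ge size_p z kn.
set A := rnm_A p z in A0 lA *; set x := cabs p.[z]; set y := cabs _ => yA.
have x0 : 0 <= x by exact: cabs_ge0.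
have y0 : 0 <= y by exact: cabs_ge0.
apply: (@le_trans _ _ (x / A)).
  rewrite ler_pdivrMr ?mulr_gt0 ?exprn_gt0//.
  rewrite (_ : x / A * _ = x * (9 * A)); last by field; rewrite gt_eqF.
  by rewrite ler_wpM2l//; lra.
by rewrite ler_wpM2l// lef_pV2 ?posrE.
Qed.

(** A nonzero derivative forces [k = 1], where the step length is known exactly. The general
    decrease is then [14/9] of the stated one, even before [A] is enlarged to [B]. *)
Lemma rnm_step_newton z (B : R) :
  p.[z] != 0 -> p^`().[z] != 0 -> rnm_A p z <= B ->
  cabs p.[N z] ^+ 2 <=
    cabs p.[z] ^+ 2 - cabs (p.[z] * p^`().[z]) ^+ 2 / (9 * B ^+ 2).
Proof.
move=> pz dpz AB; rewrite /rnm_step (negPf pz).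
have [_ _ h1 h] := rnm_iterateP n_gt0 size_p pz (thetaP pz).
have A0 := rnm_A_gt0 size_p z.
have k1 : rnm_k p z = 1%N.
  have [/andP[k0 _] _ hj] := rnm_kP n_gt0 size_p z.
  case: (ltngtP (rnm_k p z) 1) => // [|k1]; first by rewrite ltnNge k0.
  by move: dpz; rewrite -nderivn1 hj ?eqxx.
move: h; rewrite (h1 k1) {h1} rnm_uE k1 nderivn1 !normcM cabs_conj.
set A := rnm_A p z in A0 AB *.
set U := cabs p.[z] * cabs p^`().[z] => h; apply: (le_trans h).
rewrite lerD2l lerN2.
apply: (@le_trans _ _ (U ^+ 2 / (9 * A ^+ 2))).
  have B0 : 0 < B by exact: lt_le_trans A0 AB.
  rewrite ler_wpM2l ?sqr_ge0// lef_pV2 ?posrE ?mulr_gt0 ?exprn_gt0//.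
  by rewrite ler_pM2l// lerXn2r// nnegrE ltW.
rewrite (_ : 14 * _ * _ = 14 / 9 * (U ^+ 2 / (9 * A ^+ 2))); last first.
  by field; rewrite gt_eqF.
have : 0 <= U ^+ 2 / (9 * A ^+ 2).
  by rewrite divr_ge0 ?sqr_ge0// mulr_ge0 ?sqr_ge0.
lra.
Qed.

Lemma rnm_orbitS z t : orbit z t.+1 = N (orbit z t).
Proof. by []. Qed.

Lemma rnm_orbitD z s t : orbit z (s + t) = orbit (orbit z t) s.
Proof. exact: iterD. Qed.

Lemma rnm_orbit_le z s t : (s <= t)%N ->
  cabs p.[orbit z t] <= cabs p.[orbit z s].
Proof.
move=> /subnK <-; rewrite rnm_orbitD; elim: (t - s)%N => // m IH.
exact: le_trans (rnm_step_le _) IH.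
Qed.

(** Each Taylor modulus is continuous, so it attains its maximum on the compact sublevel set; the
    largest of these finitely many maxima is [A0]. *)
Lemma taylor_max z0 :
  exists A0 : R, is_max (taylor_abs_on p (sublevel p z0)) A0.
Proof.
have sp : (1 < size p)%N by rewrite size_p.
have cS := @compact_sublevel R p (cabs p.[z0]) sp.
have max_j j : exists2 z, sublevel p z0 z &
    forall w, sublevel p z0 w -> taylor_abs p w j <= taylor_abs p z j.
  have [||c cS' hc] := @compact_EVT_max R[i]^o R
      (fun z => cabs p^`N(j).[z]) _ _ cS.
  - by exists z0; rewrite /= lexx.
  - exact/continuous_subspaceT/continuous_cabs_horner.
  exists c; first by move: cS'; rewrite inE.
  by move=> w wS; rewrite !taylor_absE; apply: hc; rewrite inE.
have /choice[f fP] : forall j, exists z, sublevel p z0 z /\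
    forall w, sublevel p z0 w -> taylor_abs p w j <= taylor_abs p z j.
  by move=> j; have [z] := max_j j; exists z.
pose F (j : 'I_n.+1) := taylor_abs p (f j) j.
pose m := [arg max_(j > ord0) F j]%O.
have mP j : F j <= F m.
  by rewrite /m; case: arg_maxP => // i _; apply.
exists (F m); split.
  exists (m : nat), (f m); split; rewrite ?size_p ?leq_ord//.
  by have [] := fP m.
move=> _ [j [z [jn zS ->]]]; have [_ /(_ z zS) h] := fP j.
rewrite size_p /= -ltnS in jn.
exact: le_trans h (mP (Ordinal jn)).
Qed.

Lemma taylor_max_ge z0 (A0 : R) :
  is_max (taylor_abs_on p (sublevel p z0)) A0 ->
  0 < A0 /\ forall z, sublevel p z0 z -> rnm_A p z <= A0.
Proof.
move=> [[j [w [_ _ A0E]]] ub].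
have A00 : 0 <= A0 by rewrite A0E cabs_ge0.
have le z : sublevel p z0 z -> rnm_A p z <= A0.
  move=> zS; apply: (rnm_A_le size_p) => // i jn.
  by apply: ub; exists i, z; rewrite size_p.
split=> //; apply: lt_le_trans (rnm_A_gt0 size_p z0) (le _ _).
by rewrite /sublevel /= lexx.
Qed.

(** The drops given by [rnm_step_newton] telescope, and a square cannot become negative. Any
    positive threshold [e] is allowed, so that [rnm_orbit_to0] can use it with its own. *)
Lemma rnm_stop_bound z0 (A0 e : R) t : 0 < e ->
  is_max (taylor_abs_on p (sublevel p z0)) A0 ->
  (forall s, (s < t)%N -> e < cabs p.[orbit z0 s] /\
     e < cabs (p.[orbit z0 s] * p^`().[orbit z0 s])) ->
  t%:R <= 9 * A0 ^+ 2 * cabs p.[z0] ^+ 2 / e ^+ 2.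
Proof.
move=> e0 hA0 far; have [A00 Ale] := taylor_max_ge hA0.
pose k := e ^+ 2 / (9 * A0 ^+ 2).
have D0 : 0 < 9 * A0 ^+ 2 by rewrite mulr_gt0 ?exprn_gt0.
have e20 : 0 < e ^+ 2 by rewrite exprn_gt0.
have dec s : (s <= t)%N ->
    cabs p.[orbit z0 s] ^+ 2 <= cabs p.[z0] ^+ 2 - s%:R * k.
  elim: s => [_|s IH st]; first by rewrite mul0r subr0.
  have [h1 h2] := far s st.
  have : p.[orbit z0 s] * p^`().[orbit z0 s] != 0.
    by rewrite -cabs_gt0 (lt_trans e0).
  rewrite mulf_eq0 negb_or => /andP[q0 dq0].
  have := rnm_step_newton q0 dq0 (Ale _ (rnm_orbit_le z0 (leq0n s))).
  have : k <= cabs (p.[orbit z0 s] * p^`().[orbit z0 s]) ^+ 2 / (9 * A0 ^+ 2).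
    rewrite ler_pM2r ?invr_gt0// lerXn2r ?nnegrE ?cabs_ge0 ?(ltW e0)//.
    exact: ltW.
  have := IH (ltnW st); rewrite -rnm_orbitS -natr1.
  lra.
have := le_trans (sqr_ge0 _) (dec t (leqnn t)); rewrite subr_ge0 => h.
rewrite ler_pdivlMr//; move: h; rewrite /k mulrA ler_pdivrMr//.
by rewrite mulrC [X in _ <= X]mulrC [X in X <= _]mulrC.
Qed.

(* On the compact set [e <= |p| <= |p(z_1)|] there is no critical point, so
   |p'| is bounded below there and |p|^2 drops by a fixed amount per step. *)
Lemma rnm_orbit_to0 z0 :
  (forall w, p^`().[w] = 0 -> p.[w] <> 0 -> cabs p.[z0] <= cabs p.[w]) ->
  forall e, 0 < e -> exists T, forall t, (T <= t)%N ->
    cabs p.[orbit z0 t] < e.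
Proof.
move=> hcrit e e0.
suff [T hT] : exists T, cabs p.[orbit z0 T] < e.
  by exists T => t Tt; apply: le_lt_trans hT; exact: rnm_orbit_le.
apply: contrapT => /forallNP far'.
have far t : e <= cabs p.[orbit z0 t].
  by rewrite leNgt; apply/negP; exact: far'.
have pz0 : p.[z0] != 0 by rewrite -cabs_gt0 (lt_le_trans e0)// (far 0%N).
have sp : (1 < size p)%N by rewrite size_p.
(* Starting after one step makes the inequality with the critical moduli strict, which covers a seed
   whose modulus equals the least of them. *)
pose B := cabs p.[orbit z0 1].
have Bz0 : B < cabs p.[z0] by exact: rnm_step_lt.
pose K := [set z : R[i]^o | cabs p.[z] <= B] `&`
  [set z : R[i]^o | e <= cabs p.[z]].
have cK : compact K.
  apply: compact_closedI; first exact: compact_sublevel.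
  apply: (@preimage_closed _ _ (fun z : R[i]^o => cabs p.[z]) [set x | e <= x]).
    by move=> z _; exact: continuous_cabs_horner.
  exact: closed_ge.
have [||c cK' hc] := @compact_EVT_min R[i]^o R
    (fun z => cabs p^`().[z]) K _ cK.
- by exists (orbit z0 1); split; [rewrite /= lexx|exact: far].
- exact/continuous_subspaceT/continuous_cabs_horner.
move: cK'; rewrite inE => -[/= cB ec].
have m0 : 0 < cabs p^`().[c].
  rewrite cabs_gt0; apply/eqP => dc0.
  have pc : p.[c] <> 0 by apply/eqP; rewrite -cabs_gt0 (lt_le_trans e0).
  by have := hcrit c dc0 pc; rewrite leNgt (le_lt_trans cB).
set m := cabs p^`().[c] in hc m0.
have [A0 hA0] := taylor_max (orbit z0 1).
(* On [K] one has [|p| >= e] and [|p p'| >= e * m]; halving makes both strictly larger than [e']. *)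
pose e' := Order.min e (e * m) / 2.
have mm : 0 < Order.min e (e * m) by rewrite lt_min e0 mulr_gt0.
have e'0 : 0 < e' by rewrite divr_gt0.
have e'lt : e' < Order.min e (e * m) by rewrite /e'; lra.
pose Q := 9 * A0 ^+ 2 * cabs p.[orbit z0 1] ^+ 2 / e' ^+ 2.
have Q0 : 0 <= Q.
  by rewrite divr_ge0 ?sqr_ge0// mulr_ge0 ?sqr_ge0// mulr_ge0 ?sqr_ge0.
(* The orbit would never stop, so the bound would hold for every number of steps, in particular for
   one exceeding [Q]. *)
suff : (Num.bound Q)%:R <= Q by rewrite leNgt archi_boundP.
apply: rnm_stop_bound => //.
move=> s _; rewrite -rnm_orbitD addn1.
have h1 := far s.+1; split; apply: (lt_le_trans e'lt); rewrite ge_min.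
  by rewrite h1.
rewrite normcM ler_pM ?(ltW e0) ?(ltW m0) ?orbT//.
by apply: hc; rewrite inE; split => //; exact: (@rnm_orbit_le z0 1 s.+1).
Qed.

(** The [d] in the minimum keeps the step shorter than [d], and [d^n] puts the new point within [d]
    of some root [w]. Three distances below [d] separate [w] from [r], so they coincide. *)
Lemma rnm_step_trap r d z :
  (forall v w, root p v -> root p w -> cabs (v - w) < 3 * d -> v = w) ->
  0 < d -> root p r -> cabs (z - r) < d ->
  cabs p.[z] < lc * Order.min d (d ^+ n) ->
  cabs (N z - r) < d.
Proof.
move=> sep d0 rr zr pz.
have [||w rw hw] := @root_near R p (N z) d => //.
  apply: (le_lt_trans (rnm_step_le z)); apply: (lt_le_trans pz).
  by rewrite size_p ler_pM2l// ge_min lexx orbT.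
suff -> : r = w by [].
apply: sep => //.
have step : cabs (N z - z) < d.
  apply: (le_lt_trans (rnm_step_dist z)); rewrite ltr_pdivrMr// mulrC.
  by apply: (lt_le_trans pz); rewrite ler_pM2l// ge_min lexx.
have -> : r - w = (r - z) + (z - N z) + (N z - w) by ring.
apply: (le_lt_trans (cabsD _ _)).
have := cabsD (r - z) (z - N z); rewrite (cabsC r) (cabsC z (N z)); lra.
Qed.

Lemma rnm_orbit_trap r d z :
  (forall v w, root p v -> root p w -> cabs (v - w) < 3 * d -> v = w) ->
  0 < d -> root p r -> cabs (z - r) < d ->
  cabs p.[z] < lc * Order.min d (d ^+ n) ->
  forall t, cabs (orbit z t - r) < d.
Proof.
move=> sep d0 rr zr pz; elim=> // t IH; apply: rnm_step_trap => //.
exact: le_lt_trans (rnm_orbit_le z (leq0n t)) pz.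
Qed.

(** Once [|p|] is small, [root_near] gives a root within [min(e, d)] of the iterate; being also
    within [2d] of [r], it is [r]. *)
Lemma rnm_trapped_cvg r d z0 T :
  (forall v w, root p v -> root p w -> cabs (v - w) < 3 * d -> v = w) ->
  0 < d -> root p r ->
  (forall t, (T <= t)%N -> cabs (orbit z0 t - r) < d) ->
  (forall e, 0 < e -> exists T', forall t, (T' <= t)%N ->
    cabs p.[orbit z0 t] < e) ->
  (orbit z0 : nat -> R[i]^o) @ \oo --> (r : R[i]^o).
Proof.
move=> sep d0 rr trap to0; apply/near_cabsP => e e0.
pose b := Order.min e d.
have b0 : 0 < b by rewrite lt_min e0.
have be : b <= e by rewrite ge_min lexx.
have bd : b <= d by rewrite ge_min lexx orbT.
have [|T' hT'] := to0 (lc * b ^+ n); first by rewrite mulr_gt0 ?exprn_gt0.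
exists (maxn T T') => // t /=; rewrite geq_max => /andP[Tt T't].
have [||w rw hw] := @root_near R p (orbit z0 t) b => //.
  by rewrite size_p /=; exact: hT'.
suff -> : r = w by rewrite cabsC (lt_le_trans hw).
apply: sep => //; have -> : r - w = (r - orbit z0 t) + (orbit z0 t - w) by ring.
apply: (le_lt_trans (cabsD _ _)).
have := trap t Tt; rewrite (cabsC r); lra.
Qed.

Lemma root_trap_radius : exists2 d : R, 0 < d &
  forall v w, root p v -> root p w -> cabs (v - w) < 3 * d -> v = w.
Proof.
have [s s0 sep] := roots_separated p_neq0.
exists (s / 3); first by rewrite divr_gt0.
by move=> v w rv rw; rewrite mulrC divfK//; exact: sep.
Qed.

Lemma rnm_orbit_cvg z0 :
  (forall w, p^`().[w] = 0 -> p.[w] <> 0 -> cabs p.[z0] <= cabs p.[w]) ->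
  exists2 r, root p r & (orbit z0 : nat -> R[i]^o) @ \oo --> (r : R[i]^o).
Proof.
move=> /rnm_orbit_to0 to0; have [d d0 sep] := root_trap_radius.
have mu0 : 0 < lc * Order.min d (d ^+ n).
  by rewrite mulr_gt0// lt_min d0 exprn_gt0.
have [T hT] := to0 _ mu0.
have [||r rr hr] := @root_near R p (orbit z0 T) d => //.
  apply: (lt_le_trans (hT T (leqnn T))).
  by rewrite size_p ler_pM2l// ge_min lexx orbT.
exists r => //; apply: (@rnm_trapped_cvg r d z0 T) => // t Tt.
rewrite -(subnK Tt) rnm_orbitD; apply: rnm_orbit_trap => //.
exact: hT.
Qed.

End Dynamics.

(** * Neighbourhoods with real radii, and the moduli of [p] at critical points *)

Lemma nbhs_cabs (R : realType) (z : R[i]) (U : set R[i]) :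
  nbhs (z : R[i]^o) U ->
  exists2 d : R, 0 < d & forall w, cabs (w - z) < d -> U w.
Proof.
move=> /nbhs_ballP[e /= e0 eU].
have eR : (complex.Re e)%:C%C = e by rewrite RRe_real// gtr0_real.
exists (complex.Re e); first by rewrite -ltcR eR.
by move=> w zw; apply: eU; rewrite /ball /= -cabsE -eR ltcR cabsC.
Qed.

Lemma seq_min (R : realType) (s : seq R) : s != [::] ->
  exists2 m, m \in s & forall x, x \in s -> m <= x.
Proof.
elim: s => // x [|y s] IH _.
  by exists x => [|z]; rewrite mem_seq1// => /eqP->.
have [//|m ms mle] := IH.
have [xm|mx] := leP x m.
  exists x; first by rewrite mem_head.
  by move=> z; rewrite in_cons => /predU1P[->//|/mle]; apply: le_trans.
exists m; first by rewrite in_cons ms orbT.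
by move=> z; rewrite in_cons => /predU1P[->|/mle//]; exact: ltW.
Qed.

Section CriticalModuli.
Variables (R : realType) (n : nat) (p : {poly R[i]}).
Hypotheses (n_gt0 : (0 < n)%N) (size_p : size p = n.+1).

(** Were [p'] zero, every higher derivative would vanish too, against the nonzero one of order
    [k >= 1] at the point 0. *)
Lemma deriv_neq0 : p^`() != 0.
Proof.
apply/eqP => dp; have [/andP[k0 _] + _] := rnm_kP n_gt0 size_p 0.
rewrite -derivn_eq0; case: (rnm_k p 0) k0 => // k _.
by rewrite derivSn dp linear0 horner0 eqxx.
Qed.

(** The nonzero polynomial [p'] has finitely many roots, so the critical moduli form a finite list,
    with the value [+oo] when it is empty. *)
Lemma critical_moduli_min : exists M, is_emin (critical_moduli p) M.
Proof.
have [l lE] := closed_field_poly_normal p^`().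
have lP w : (p^`().[w] == 0) = (w \in l).
  by rewrite -rootE lE rootZ ?lead_coef_eq0 ?deriv_neq0// root_prod_XsubC.
pose s := [seq cabs p.[w] | w <- l & p.[w] != 0].
have sP x : critical_moduli p x <-> exists2 y, y \in s & x = y%:E.
  split=> [[w [/eqP dw /eqP pw] <-]|[_ /mapP[w + ->] ->]].
    exists (cabs p.[w]) => //; apply: map_f.
    by rewrite mem_filter pw -lP.
  by rewrite mem_filter -lP => /andP[/eqP pw /eqP dw]; exists w.
have [s0|/seq_min[m ms mle]] := eqVneq s [::].
  exists +oo%E; right; split => //.
  by rewrite -subset0 => x /sP[y]; rewrite s0.
exists m%:E; left; split; first by apply/sP; exists m.
by move=> _ /sP[y /mle ym ->]; rewrite lee_fin.
Qed.

Lemma le_critical_min (z : R[i]) M : is_emin (critical_moduli p) M ->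
  ((cabs p.[z])%:E <= M)%E ->
  forall w, p^`().[w] = 0 -> p.[w] <> 0 -> cabs p.[z] <= cabs p.[w].
Proof.
move=> hM zM w dw pw.
have wM : critical_moduli p (cabs p.[w])%:E by exists w.
case: hM => [[_ lb]|[M0 _]]; last by rewrite M0 in wM.
by rewrite -lee_fin (le_trans zM)// lb.
Qed.

(** A real threshold for (iv), under which a seed satisfies the hypothesis of [rnm_orbit_to0]; 1
    serves when there is no critical modulus. *)
Lemma critical_moduli_gt : exists2 m : R, 0 < m &
  forall w, p^`().[w] = 0 -> p.[w] <> 0 -> m <= cabs p.[w].
Proof.
have [M [[[v [_ /eqP pv] <-] lb]|[M0 _]]] := critical_moduli_min.
  exists (cabs p.[v]); first by rewrite cabs_gt0.
  by move=> w dw pw; rewrite -lee_fin lb//; exists w.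
exists 1 => // w dw pw.
have : critical_moduli p (cabs p.[w])%:E by exists w.
by rewrite M0.
Qed.

End CriticalModuli.

(** * Assembly of the five claims *)

Theorem theorem2 (R : realType) (n : nat) (p : {poly R[i]})
    (hn : (2 <= n)%N) (hp : size p = n.+1)
    (theta : R[i] -> R)
    (htheta : forall z : R[i], p.[z] != 0 -> rnm_angle p z (theta z))
    (eps : R) (heps0 : 0 <= eps) (heps1 : eps < 1)
    (z0 : R[i]) (hz0 : eps < cabs p.[z0]) :
  let z_ := rnm_orbit p theta z0 in
  [/\ (* (i) *)
      range z_ `<=` sublevel p z0,
      (* (ii) *)
      exists A0 : R,
        [/\ is_max (taylor_abs_on p (sublevel p z0)) A0,
            0 < eps ->
              let stop t := cabs p.[z_ t] <= eps \/
                            cabs (p.[z_ t] * p^`().[z_ t]) <= eps in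
              exists t : nat,
                [/\ stop t, forall s : nat, stop s -> (t <= s)%N
                  & t%:R <= 9 * A0 ^+ 2 * cabs p.[z0] ^+ 2 / eps ^+ 2]
          & (fun e : R => 9 * A0 ^+ 2 * cabs p.[z0] ^+ 2 / e ^+ 2)
              =O_ (0^'+) (fun e : R => 1 / e ^+ 2)],
      (* (iii) *)
      exists M : \bar R, is_emin (critical_moduli p) M /\
        (((cabs p.[z0])%:E <= M)%E ->
           exists2 r : R[i], root p r & (z_ : nat -> R[i]^o) @ \oo --> (r : R[i]^o)),
      (* (iv) *)
      forall r : R[i], root p r ->
        exists2 d : R, 0 < d &
          [set z : R[i] | cabs (z - r) < d] `<=` rnm_basin p theta r
    & (* (v) *)
      forall c : R[i], p^`().[c] = 0 -> p.[c] <> 0 ->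
        forall U : set R[i], nbhs (c : R[i]^o) U ->
          exists z : R[i],
            [/\ U z, p.[z] != 0,
                cabs p.[rnm_iterate p z (theta z)] < cabs p.[c]
              & ~ ((rnm_orbit p theta z : nat -> R[i]^o) @ \oo --> (c : R[i]^o))] ].
Proof.
move=> z_; have n0 : (0 < n)%N by exact: ltnW.
have orbit_le := rnm_orbit_le n0 hp htheta.
split.
- by move=> _ [t _ <-]; exact: (orbit_le z0 0%N t).
- have [A0 hA0] := taylor_max n0 hp z0; exists A0; split => // [eps0 stop|].
    pose Q := 9 * A0 ^+ 2 * cabs p.[z0] ^+ 2 / eps ^+ 2.
    have Q0 : 0 <= Q.
      by rewrite divr_ge0 ?sqr_ge0// mulr_ge0 ?sqr_ge0// mulr_ge0 ?sqr_ge0.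
    (* Stated for any [t] not preceded by a stopping time, this yields both the existence of a
       stopping time and the estimate for the least one. *)
    have bound t : (forall s, (s < t)%N -> ~ stop s) -> t%:R <= Q.
      move=> hs; apply: (rnm_stop_bound n0 hp htheta) => // s /hs /not_orP[].
      by move=> /negP; rewrite -ltNge => ? /negP; rewrite -ltNge.
    have ex : exists t, `[< stop t >].
      apply: contrapT => /forallNP nostop.
      have : (Num.bound Q)%:R <= Q.
        by apply: bound => s _ /asboolP; exact: nostop.
      by rewrite leNgt archi_boundP.
    case: (ex_minnP ex) => t /asboolP st tmin; exists t; split => //.
      by move=> s /asboolP; exact: tmin.
    by apply: bound => s st' /asboolP /tmin; rewrite leqNgt st'.
  (* The added 1 makes the constant strictly positive. *)
  apply/eqO_exP; exists (`|9 * A0 ^+ 2 * cabs p.[z0] ^+ 2| + 1).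
    by rewrite ltr_wpDl.
  near=> e; rewrite mul1r normrM ler_wpM2r//.
  by rewrite lerDl.
- have [M hM] := critical_moduli_min n0 hp; exists M; split => // z0M.
  apply: (rnm_orbit_cvg n0 hp htheta).
  exact: le_critical_min hM z0M.
- move=> r rr; have [d d0 sep] := root_trap_radius hp.
  have [m m0 hm] := critical_moduli_gt n0 hp.
  have l0 := lead_gt0 hp.
  (* Below [m] the values of [p] along the orbit tend to 0; below the other term the orbit is
     trapped near [r], from time 0 on. *)
  pose mu := Order.min m (cabs (lead_coef p) * Order.min d (d ^+ n)).
  have mu0 : 0 < mu by rewrite lt_min m0 mulr_gt0// lt_min d0 exprn_gt0.
  have : nbhs (r : R[i]^o) [set z | cabs p.[z] < mu].
    have h := (@cvgrPdist_lt _ _ _ _ (nbhs_filter (r : R[i]^o)) _ _).1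
      (@continuous_cabs_horner R p r) mu mu0.
    apply: (@filterS _ (nbhs (r : R[i]^o)) (nbhs_filter (r : R[i]^o)) _ _ _ h).
    move=> z /=; rewrite (rootP rr) cabs0 sub0r normrN ger0_norm//.
    exact: cabs_ge0.
  move=> /nbhs_cabs[d' d'0 hd']; exists (Order.min d d').
    by rewrite lt_min d0.
  move=> z /=; rewrite lt_min => /andP[zd /hd' /=].
  rewrite lt_min => /andP[zm zl].
  apply: (@rnm_trapped_cvg _ _ _ _ hp r d z 0) => //.
    by move=> t _; apply: (rnm_orbit_trap n0 hp htheta).
  apply: (rnm_orbit_to0 n0 hp htheta) => w dw pw.
  exact: le_trans (ltW zm) (hm w dw pw).
(* The point [c] itself is the witness, since a step decreases [|p|] even where [p'] vanishes. *)
move=> c dc /eqP pc U cU; exists c.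
have lt1 := rnm_step_lt n0 hp htheta pc.
split => //; first exact: nbhs_singleton cU.
  by move: lt1; rewrite /rnm_step (negPf pc).
move=> cvgc.
(* From time 1 on, [|p|] stays at least [e] below [|p(c)|], which continuity at [c] forbids if the
   orbit tends to [c]. *)
pose e := cabs p.[c] - cabs p.[rnm_step p theta c].
have e0 : 0 < e by rewrite subr_gt0.
have h := (@cvgrPdist_lt _ _ _ _ (nbhs_filter (c : R[i]^o)) _ _).1
  (@continuous_cabs_horner R p c) e e0.
have [T _ hT] := cvgc _ h.
(* The index must be at least 1, as the orbit is at [c] at time 0. *)
have /= := hT (maxn T 1) (leq_maxl _ _).
have := orbit_le c 1%N (maxn T 1) (leq_maxr _ _).
rewrite [rnm_orbit p theta c 1]/(rnm_step p theta c) => le1.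
rewrite ltNge => /negP[]; apply: le_trans (ler_norm _).
by rewrite lerD2l lerN2.
Unshelve. all: by end_near.
Qed.
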